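(* For every $n\ge 1$, the linear extension diameter of the Boolean lattice $B_n$ is $\mathrm{led}(B_n)=2^{2n-2}-(n+1)\cdot 2^{n-2}$.
   Context: $B_n$ is the poset of all subsets of $[n]$ ordered by inclusion. The distance between two linear extensions of a finite poset $\mathcal{P}$ is the number of unordered pairs of elements of $\mathcal{P}$ appearing in different orders in them; the linear extension diameter $\mathrm{led}(\mathcal{P})$ is the maximum distance over all pairs of linear extensions of $\mathcal{P}$. *)

(* Defs.v *)
From HB Require Import structures.
From mathcomp Require Import all_boot all_order.

Set Implicit Arguments.
Unset Strict Implicit.
Unset Printing Implicit Defensive.

Import Order.Theory.

Section LinearExtensionDiameter.

Variables (d : Order.disp_t) (P : finPOrderType d).

Definition before (L : seq P) (x y : P) : bool := index x L < index y L.

(* A linear extension is given as a listing of all the elements of P, each    *)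
(* exactly once, that is compatible with the order of P.                      *)
Definition linear_extension (L : #|P|.-tuple P) : bool :=
  uniq L && [forall x : P, forall y : P, (x < y)%O ==> before L x y].

Definition reversed_pairs (L1 L2 : #|P|.-tuple P) : {set {set P}} :=
  [set [set p.1; p.2] | p : P * P & before L1 p.1 p.2 && before L2 p.2 p.1].

Definition distance (L1 L2 : #|P|.-tuple P) : nat := #|reversed_pairs L1 L2|.

Definition led : nat :=
  \max_(L : #|P|.-tuple P * #|P|.-tuple P
          | linear_extension L.1 && linear_extension L.2) distance L.1 L.2.

End LinearExtensionDiameter.

Arguments led {d} P.

(* The order of {set 'I_n} provided by DefaultSetSubsetOrder is inclusion.    *)
Import Order.DefaultSetSubsetOrder.

Definition boolean_lattice (n : nat) : finPOrderType _ := {set 'I_n}.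

Lemma le_boolean_lattice (n : nat) (A B : boolean_lattice n) :
  (A <= B)%O = (A \subset B).
Proof. by []. Qed.

(* Main.v *)
(* Upper bound. The unordered pairs {A, B} are grouped by D, the symmetric    *)
(* difference of A and B, and C = A :&: B; the pairs of a group are the        *)
(* antipodal pairs of the cube of all C :|: X with X \subset D. For a linear   *)
(* extension, the X such that C :|: X precedes its antipode form a down-set    *)
(* containing exactly one of X and D :\: X. Two such down-sets of the subsets  *)
(* of D are positively correlated, so they share at least a quarter of these   *)
(* subsets, and at most half of the pairs of the group are reversed. None is   *)
(* when #|D| <= 1.                                                             *)
(* Lower bound. Reading sets as binary numbers, with the most significant bit  *)
(* at either end, gives two linear extensions for which the two down-sets are  *)
(* "M is not in X" and "m is not in X", M and m being the last and the first   *)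
(* element of D; exactly half of the pairs are reversed as soon as 1 < #|D|.   *)
Require Import Defs.
From HB Require Import structures.
From mathcomp Require Import all_boot all_order all_algebra.
From mathcomp Require Import zify ring.

Set Implicit Arguments.
Unset Strict Implicit.
Unset Printing Implicit Defensive.

Import Order.Theory GRing.Theory Num.Theory.
Import Order.DefaultSetSubsetOrder.

Section Powersets.

Variable T : finType.
Implicit Types C D X : {set T}.

Lemma set_ind (P : {set T} -> Prop) :
    P set0 -> (forall x D, x \notin D -> P D -> P (x |: D)) ->
  forall D, P D.
Proof.
move=> P0 PU D; have [m] := ubnP #|D|; elim: m D => // m IH D.
have [->//|[x xD]] := set_0Vmem D.
rewrite (cardsD1 x) xD add1n ltnS => Dm.
by rewrite -(setD1K xD); apply: PU; [rewrite setD11 | apply: IH].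
Qed.

Section BigOperators.

Variables (R : Type) (idx : R) (op : Monoid.com_law idx).

Lemma big_powersetU1 (h : {set T} -> R) x D : x \notin D ->
  \big[op/idx]_(X in powerset (x |: D)) h X =
  op (\big[op/idx]_(X in powerset D) h X)
     (\big[op/idx]_(X in powerset D) h (x |: X)).
Proof.
move=> xD; rewrite (bigID (fun X => x \notin X)) /=; congr (op _ _).
  by apply: eq_bigl => X; rewrite !powersetE -subsetD1 setU1K.
rewrite (reindex_onto (fun X => x |: X) (fun X => X :\ x)) /=; last first.
  by move=> X /andP[_]; rewrite negbK => xX; rewrite setD1K.
apply: eq_bigl => X; rewrite !powersetE setU11 andbT.
apply/andP/idP => [[XD /eqP <-]|XD]; first by rewrite subDset.
by rewrite setUS ?setU1K ?eqxx //; apply: contra (subsetP XD x) xD.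
Qed.

(* Here C = A :&: B, X = A :\: B and D is the symmetric difference of A and B. *)
Lemma big_set_pairs (h : {set T} -> {set T} -> R) :
  \big[op/idx]_A \big[op/idx]_B h A B =
  \big[op/idx]_D \big[op/idx]_(C in powerset (~: D))
    \big[op/idx]_(X in powerset D) h (C :|: X) (C :|: (D :\: X)).
Proof.
under [RHS]eq_bigr do rewrite pair_big_dep.
rewrite pair_big_dep [RHS]pair_big_dep /=.
pose pair_of (t : {set T} * ({set T} * {set T})) :=
  (t.2.1 :|: t.2.2, t.2.1 :|: (t.1 :\: t.2.2)).
pose triple_of (p : {set T} * {set T}) :=
  ((p.1 :\: p.2) :|: (p.2 :\: p.1), (p.1 :&: p.2, p.1 :\: p.2)).
rewrite (reindex_onto pair_of triple_of) /= => [|[A B] _]; last first.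
  by congr (_, _); apply/setP => x; rewrite !inE; do 2 case: (_ \in _).
apply: eq_bigl => -[D [C X]]; rewrite !powersetE /=.
apply/eqP/andP => [[eqD _ eqX]|[/subsetP CD /subsetP XD]].
  split; last by rewrite -{1}eqX -{2}eqD subsetUl.
  by rewrite -eqD; apply/subsetP => x xC; rewrite !inE xC.
congr (_, (_, _)); apply/setP => x; have := CD x; have := XD x; rewrite !inE;
  case: (x \in X) => [->//|_]; case: (x \in C) => [/(_ isT)/negPf->//|_];
  by case: (x \in D).
Qed.

End BigOperators.

Lemma card_sets_gt1 : #|[set D : {set T} | 1 < #|D|]| = 2 ^ #|T| - #|T|.+1.
Proof.
have <- : #|{set T}| = 2 ^ #|T|.
  by rewrite -(cardsT T) -card_powerset powersetT cardsT.
suff <- : #|~: [set D : {set T} | 1 < #|D|]| = #|T|.+1.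
  by rewrite -(cardsC [set D : {set T} | 1 < #|D|]) addnK.
have -> : ~: [set D : {set T} | 1 < #|D|] =
    [set D : {set T} | #|D| == 1] :|: [set D : {set T} | #|D| == 0].
  by apply/setP => D; rewrite !inE; case: #|D| => [|[]].
rewrite cardsU !card_draws bin1 bin0 addn1.
suff -> : [set D : {set T} | #|D| == 1] :&: [set D : {set T} | #|D| == 0] = set0.
  by rewrite cards0 subn0.
by apply/setP => D; rewrite !inE; case: eqP => // ->.
Qed.

Lemma card_subsets_separating D x y : x \in D -> y \in D -> x != y ->
  4 * #|[set X in powerset D | (x \in X) && (y \notin X)]| = 2 ^ #|D|.
Proof.
move=> xD yD xy; have xDy : x \in D :\ y by rewrite !inE xy.
have -> : [set X in powerset D | (x \in X) && (y \notin X)] =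
    powerset (D :\ y) :\: powerset (D :\ y :\ x).
  apply/setP => X; rewrite !inE !subsetD1.
  by case: (X \subset D); case: (x \in X); case: (y \in X).
rewrite cardsD (setIidPr _) ?powersetS ?subD1set // !card_powerset.
by rewrite (cardsD1 y D) yD (cardsD1 x (D :\ y)) xDy !add1n !expnS; lia.
Qed.

End Powersets.

Section Correlation.

Variable T : finType.
Implicit Types (D X Y : {set T}) (F G : {set {set T}}).

Definition antitone (R : numDomainType) (f : {set T} -> R) : Prop :=
  {homo f : X Y / X \subset Y >-> (Y <= X)%R}.

Lemma Harris_inequality (R : numDomainType) (f g : {set T} -> R) D :
    antitone f -> antitone g ->
  ((\sum_(X in powerset D) f X) * (\sum_(X in powerset D) g X) <=
   2 ^+ #|D| * \sum_(X in powerset D) f X * g X)%R.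
Proof.
elim/set_ind: D f g => [|x D xD IH] f g f_anti g_anti.
  by rewrite powerset0 !big_set1 cards0 mul1r.
rewrite !big_powersetU1 // cardsU1 xD exprS /=.
have anti_link (h : {set T} -> R) : antitone h -> antitone (fun X => h (x |: X)).
  by move=> h_anti X Y XY; apply/h_anti/setUS.
have diff_ge0 (h : {set T} -> R) : antitone h ->
    (0 <= \sum_(X in powerset D) h X - \sum_(X in powerset D) h (x |: X))%R.
  by move=> h_anti; rewrite subr_ge0 ler_sum // => X _; apply/h_anti/subsetUr.
have := mulr_ge0 (diff_ge0 _ f_anti) (diff_ge0 _ g_anti).
have := IH _ _ (anti_link _ f_anti) (anti_link _ g_anti).
have := IH _ _ f_anti g_anti.
set f0 := (\sum_(X in powerset D) f X)%R.
set f1 := (\sum_(X in powerset D) f (x |: X))%R.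
set g0 := (\sum_(X in powerset D) g X)%R.
set g1 := (\sum_(X in powerset D) g (x |: X))%R.
set s0 := (\sum_(X in powerset D) f X * g X)%R.
set s1 := (\sum_(X in powerset D) f (x |: X) * g (x |: X))%R.
rewrite -subr_ge0 => le_base; rewrite -subr_ge0 => le_link le_cross.
rewrite -subr_ge0.
have -> : (2 * 2 ^+ #|D| * (s0 + s1) - (f0 + f1) * (g0 + g1) =
    2 * (2 ^+ #|D| * s0 - f0 * g0) + 2 * (2 ^+ #|D| * s1 - f1 * g1)
    + (f0 - f1) * (g0 - g1))%R by ring.
by rewrite !addr_ge0 // mulr_ge0.
Qed.

Definition down_closed F : Prop := forall X Y, X \subset Y -> Y \in F -> X \in F.

Lemma Kleitman_inequality D F G :
    F \subset powerset D -> G \subset powerset D ->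
    down_closed F -> down_closed G ->
  #|F| * #|G| <= 2 ^ #|D| * #|F :&: G|.
Proof.
move=> FD GD F_down G_down.
pose ind (H : {set {set T}}) (X : {set T}) : int := ((X \in H)%:R)%R.
have ind_anti H : down_closed H -> antitone (ind H).
  move=> H_down X Y XY; rewrite /ind.
  by have := H_down X Y XY; case: (Y \in H) => [->|_].
have sum_ind (H : {set {set T}}) : H \subset powerset D ->
    (\sum_(X in powerset D) ind H X)%R = (#|H|%:R)%R.
  move=> HD; rewrite -natr_sum; congr (_%:R)%R.
  rewrite -big_mkcondr -sum1_card; apply: eq_bigl => X.
  by rewrite -in_setI (setIidPr HD).
have := Harris_inequality D (ind_anti F F_down) (ind_anti G G_down).
under [X in (_ <= _ * X)%R]eq_bigr => X _.
  rewrite /ind -natrM mulnb -in_setI; over.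
rewrite [X in (_ <= _ * X)%R]sum_ind ?subIset ?FD // !sum_ind //.
by rewrite -natrX -!natrM ler_nat.
Qed.

Definition complement_transversal D F : Prop :=
  F \subset powerset D /\ {in powerset D, forall X, (D :\: X \in F) = (X \notin F)}.

Lemma card_complement_transversal D F :
  complement_transversal D F -> 2 * #|F| = 2 ^ #|D|.
Proof.
move=> [FD compl]; rewrite -card_powerset -(cardsID F (powerset D)).
rewrite (setIidPr FD) mul2n -addnn; congr (_ + _).
have DK : {in powerset D, involutive (setD D)}.
  by move=> X; rewrite powersetE => /setIidPr XD; rewrite setDDr setDv set0U.
rewrite -(@card_in_imset _ _ (setD D)); last first.
  by move=> X Y /(subsetP FD)/DK {2}<- /(subsetP FD)/DK {2}<- ->.
apply: eq_card => X; rewrite inE; apply/imsetP/andP => [[Y YF ->]|[XF XD]].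
  have YD := subsetP FD _ YF.
  by rewrite compl // YF powersetE subsetDl.
by exists (D :\: X); rewrite ?compl ?DK.
Qed.

Lemma card_transversalD_le D F G :
    complement_transversal D F -> complement_transversal D G ->
    down_closed F -> down_closed G ->
  4 * #|F :\: G| <= 2 ^ #|D|.
Proof.
move=> F_half G_half F_down G_down.
have card_F := card_complement_transversal F_half.
have card_G := card_complement_transversal G_half.
have common_ge : 2 ^ #|D| <= 4 * #|F :&: G|.
  rewrite -(@leq_pmul2l (2 ^ #|D|)) ?expn_gt0 // mulnCA -{1}card_F -{1}card_G mulnACA.
  by rewrite leq_mul2l Kleitman_inequality ?F_half.1 ?G_half.1.
by have := cardsID G F; lia.
Qed.

End Correlation.

Section LinearRanks.

Variables (d : Order.disp_t) (P : finPOrderType d).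
Implicit Types (L : #|P|.-tuple P) (r : P -> nat).

(* Up to order isomorphism of its values, a linear rank is a linear extension. *)
Definition linear_rank r : Prop :=
  injective r /\ {homo r : x y / (x < y)%O >-> x < y}.

Lemma linear_rank_le r : linear_rank r -> {homo r : x y / (x <= y)%O >-> x <= y}.
Proof. by move=> [_ r_mono] x y; rewrite le_eqVlt => /predU1P[->|/r_mono/ltnW]. Qed.

Definition inversions r1 r2 : {set P * P} :=
  [set p | (r1 p.1 < r1 p.2) && (r2 p.2 < r2 p.1)].

Lemma index_linear_rank L : linear_extension L -> linear_rank (index^~ L).
Proof.
move=> /andP[L_uniq /forallP L_ext].
have L_enum : {subset L <= enum P} by move=> x _; rewrite mem_enum.
have mem_L x : x \in L.
  by rewrite (uniq_min_size L_uniq L_enum) ?mem_enum // -cardE size_tuple.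
split=> [x y|x y]; first exact: index_inj.
exact: implyP (forallP (L_ext x) y).
Qed.

Lemma linear_rank_extension r : linear_rank r ->
  exists2 L, linear_extension L & forall x y, before L x y = (r x < r y).
Proof.
move=> [r_inj r_mono]; pose s := sort (relpre r leq) (enum P).
have size_s : size s == #|P| by rewrite size_sort -cardE.
have mem_s x : x \in s by rewrite mem_sort mem_enum.
have r_trans : transitive (relpre r leq) by move=> ? ? ?; apply: leq_trans.
have r_total : total (relpre r leq) by move=> ? ?; apply: leq_total.
have s_sorted x y : index x s < index y s -> r x <= r y.
  exact: (sorted_ltn_index r_trans (sort_sorted r_total _)).
have s_before x y : (index x s < index y s) = (r x < r y).
  apply/idP/idP => [xy|]; last first.
    apply: contraLR; rewrite -!leqNgt leq_eqVlt.
    by move=> /predU1P[/index_inj->|/s_sorted].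
  rewrite ltn_neqAle s_sorted // andbT; apply: contraTneq xy => /r_inj->.
  by rewrite ltnn.
exists (Tuple size_s) => //; rewrite /linear_extension /= sort_uniq enum_uniq /=.
apply/forallP => x; apply/forallP => y; apply/implyP => /r_mono.
by rewrite /before s_before.
Qed.

Lemma distanceE L1 L2 : distance L1 L2 = #|inversions (index^~ L1) (index^~ L2)|.
Proof.
rewrite /distance /reversed_pairs card_in_imset // => -[x y] [x' y'].
rewrite !inE /before /= => /andP[xy _] /andP[xy' _] /setP eq_xy.
have /set2P : x \in [set x'; y'] by rewrite -eq_xy set21.
have /set2P : y \in [set x'; y'] by rewrite -eq_xy set22.
by case=> ? [] ?; subst=> //; lia.
Qed.

Lemma inversions_le_led r1 r2 :
  linear_rank r1 -> linear_rank r2 -> #|inversions r1 r2| <= led P.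
Proof.
move=> /linear_rank_extension[L1 L1_ext E1] /linear_rank_extension[L2 L2_ext E2].
have -> : #|inversions r1 r2| = distance L1 L2.
  by rewrite distanceE; apply: eq_card => p; rewrite !inE -E1 -E2.
apply: (@leq_bigmax_cond _ _ (fun p => distance p.1 p.2) (L1, L2)).
by rewrite L1_ext.
Qed.

Lemma led_eq_inversions r1 r2 : linear_rank r1 -> linear_rank r2 ->
    (forall s1 s2, linear_rank s1 -> linear_rank s2 ->
       #|inversions s1 s2| <= #|inversions r1 r2|) ->
  led P = #|inversions r1 r2|.
Proof.
move=> r1_lin r2_lin r_max; apply/eqP; rewrite eqn_leq inversions_le_led // andbT.
apply/bigmax_leqP => -[L1 L2] /= /andP[L1_ext L2_ext].
by rewrite distanceE; apply: r_max; apply: index_linear_rank.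
Qed.

End LinearRanks.

Lemma ltEproper (T : finType) (A B : {set T}) : (A < B)%O = (A \proper B).
Proof. by []. Qed.

Section AntipodalPairs.

Variable T : finType.
Implicit Types (A B C D X Y : {set T}) (r : {set T} -> nat).

(* The sets C :|: X with X \subset D are the vertices of a cube, in which the *)
(* antipode of C :|: X is C :|: (D :\: X).                                    *)
Definition antipodal_lower r C D : {set {set T}} :=
  [set X in powerset D | r (C :|: X) < r (C :|: (D :\: X))].

Lemma card_inversions_antipodal r1 r2 : injective r2 ->
  #|inversions r1 r2| =
  \sum_D \sum_(C in powerset (~: D))
    #|antipodal_lower r1 C D :\: antipodal_lower r2 C D|.
Proof.
move=> r2_inj; transitivity (\sum_A \sum_B ((A, B) \in inversions r1 r2)).
  by rewrite pair_bigA -sum1_card big_mkcond; apply: eq_bigr => -[A B].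
rewrite big_set_pairs; apply: eq_bigr => D _; apply: eq_bigr => C _.
rewrite -big_mkcondr -sum1_card; apply: eq_bigl => X; rewrite !inE /=.
case: (X \subset D); rewrite ?andbF //= -leqNgt andbC; apply: andb_id2r => lt_r1.
rewrite [RHS]leq_eqVlt (inj_eq r2_inj).
by case: eqP => // eqX; rewrite eqX ltnn in lt_r1.
Qed.

Lemma sum_cubes_gt1 :
  \sum_(D : {set T}) \sum_(C in powerset (~: D)) 2 ^ #|D| * (1 < #|D|) =
  2 ^ #|T| * (2 ^ #|T| - #|T|.+1).
Proof.
rewrite -card_sets_gt1 -sum1dep_card [in RHS]big_mkcond big_distrr /=.
apply: eq_bigr => D _; rewrite sum_nat_const card_powerset mulnA -expnD.
by rewrite addnC cardsC; case: (1 < _).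
Qed.

Section LinearRankCubes.

Variables (r : {set T} -> nat) (C D : {set T}).
Hypotheses (r_lin : linear_rank r) (CD : [disjoint C & D]).

Lemma antipodal_lower_down_closed : down_closed (antipodal_lower r C D).
Proof.
move=> X Y XY; rewrite !inE => /andP[YD lt_Y]; rewrite (subset_trans XY YD) /=.
apply: leq_ltn_trans (leq_trans lt_Y _).
  exact/(linear_rank_le r_lin)/setUS.
exact/(linear_rank_le r_lin)/setUS/setDS.
Qed.

Lemma antipodal_lower_transversal : D != set0 ->
  complement_transversal D (antipodal_lower r C D).
Proof.
move=> /set0Pn[x xD]; split.
  by apply/subsetP => X; rewrite inE => /andP[].
move=> X XD; rewrite !inE subsetDl -[X \subset D]powersetE XD /= -leqNgt.
rewrite setDDr setDv set0U (setIidPr _) -?powersetE //.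
rewrite [RHS]leq_eqVlt (inj_eq r_lin.1).
case: eqP => // /setP/(_ x); rewrite !inE xD (disjointFl CD xD) andbT.
by case: (x \in X).
Qed.

End LinearRankCubes.

Lemma antipodal_lowerD_small r1 r2 C D : linear_rank r1 -> linear_rank r2 ->
  #|D| <= 1 -> antipodal_lower r1 C D :\: antipodal_lower r2 C D = set0.
Proof.
move=> r1_lin r2_lin D_small; apply/eqP; rewrite setD_eq0; apply/subsetP => X.
rewrite !inE => /andP[XD lt_r1]; rewrite XD /=; apply: r2_lin.2; rewrite lt_neqAle.
have -> /= : C :|: X != C :|: (D :\: X).
  by apply: contraTneq lt_r1 => ->; rewrite ltnn.
have [X0|DX0] : X = set0 \/ D :\: X = set0; first last.
- by move: lt_r1; rewrite ltnNge DX0 (linear_rank_le r1_lin) //; apply/setUS/sub0set.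
- by rewrite X0; apply/setUS/sub0set.
have := cardsID X D; rewrite (setIidPr XD) => card_D.
by have [/cards0_eq|X_gt0] := posnP #|X|; [left | right; apply/cards0_eq; lia].
Qed.

Lemma card_antipodal_inversions_le r1 r2 C D :
    linear_rank r1 -> linear_rank r2 -> [disjoint C & D] ->
  4 * #|antipodal_lower r1 C D :\: antipodal_lower r2 C D| <= 2 ^ #|D| * (1 < #|D|).
Proof.
move=> r1_lin r2_lin CD; case: ltnP => [D_large|D_small]; last first.
  by rewrite (antipodal_lowerD_small C r1_lin r2_lin) ?cards0.
have D_neq0 : D != set0 by rewrite -card_gt0 ltnW.
rewrite muln1; apply: card_transversalD_le.
- exact: antipodal_lower_transversal.
- exact: antipodal_lower_transversal.
- exact: antipodal_lower_down_closed.
- exact: antipodal_lower_down_closed.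
Qed.

Lemma card_inversions_le r1 r2 : linear_rank r1 -> linear_rank r2 ->
  4 * #|inversions r1 r2| <= 2 ^ #|T| * (2 ^ #|T| - #|T|.+1).
Proof.
move=> r1_lin r2_lin; rewrite (card_inversions_antipodal _ r2_lin.1) -sum_cubes_gt1.
rewrite big_distrr leq_sum //= => D _; rewrite big_distrr leq_sum //= => C.
rewrite powersetCE => CD; exact: card_antipodal_inversions_le.
Qed.

End AntipodalPairs.

Section BinaryRank.

Variables (T : finType) (w : T -> nat).
Hypothesis w_inj : injective w.
Implicit Types A B C D X Y : {set T}.

Definition binary_rank A : nat := \sum_(i in A) 2 ^ w i.

Lemma binary_rank_lt_exp A m : {in A, forall i, w i < m} -> binary_rank A < 2 ^ m.
Proof.
elim: m A => [|m IH] A w_lt.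
  by rewrite /binary_rank big1 // => i /w_lt.
have [i /andP[iA /eqP wi]|w_neq] := pickP (fun i => (i \in A) && (w i == m)).
  rewrite /binary_rank (big_setD1 i iA) /= expnS mul2n -addnn wi ltn_add2l.
  apply: IH => j; rewrite !inE => /andP[ji /w_lt].
  by rewrite ltnS leq_eqVlt -wi (inj_eq w_inj) (negPf ji).
apply: ltn_trans (IH A _) _; last by rewrite ltn_exp2l.
by move=> j jA; have := w_lt _ jA; have := w_neq j; rewrite jA /=; lia.
Qed.

Lemma binary_rank_lt A B i : i \in B :\: A ->
  {in A :\: B, forall j, w j < w i} -> binary_rank A < binary_rank B.
Proof.
move=> iBA /binary_rank_lt_exp lt_i.
rewrite /binary_rank (big_setID B) [ltnRHS](big_setID A) /= setIC ltn_add2l.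
by rewrite [ltnRHS](big_setD1 i) //=; apply: leq_trans lt_i (leq_addr _ _).
Qed.

Lemma binary_rank_inj : injective binary_rank.
Proof.
move=> A B eq_rank; apply/eqP; rewrite eqEsubset -!setD_eq0 -setU_eq0.
apply: contraT => /set0Pn[i0 i0AB].
have [i iAB i_max] := arg_maxnP w i0AB.
have w_lt j : j != i -> j \in (A :\: B) :|: (B :\: A) -> w j < w i.
  by move=> ji /i_max le_ji; rewrite ltn_neqAle (inj_eq w_inj) ji.
have neq_ij j A' B' : i \in A' :\: B' -> j \in B' :\: A' -> j != i.
  by rewrite !inE => /andP[iB _] /andP[_ jB]; apply: contraNneq iB => <-.
case/setUP: iAB => iAB.
  suff: binary_rank B < binary_rank A by rewrite eq_rank ltnn.
  apply: (binary_rank_lt iAB) => j jBA.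
  by apply: w_lt; [exact: neq_ij iAB jBA | rewrite inE jBA orbT].
suff: binary_rank A < binary_rank B by rewrite eq_rank ltnn.
apply: (binary_rank_lt iAB) => j jAB.
by apply: w_lt; [exact: neq_ij iAB jAB | rewrite inE jAB].
Qed.

Lemma binary_rank_linear : linear_rank binary_rank.
Proof.
split; first exact: binary_rank_inj.
move=> A B; rewrite ltEproper => /properP[AB [i iB iA]].
apply: (@binary_rank_lt _ _ i); first by rewrite inE iA.
by move=> j /setDP[/(subsetP AB)->].
Qed.

Lemma mem_antipodal_lower_binary_rank C D X M :
    [disjoint C & D] -> X \subset D -> M \in D ->
    {in D, forall i, w i <= w M} ->
  (X \in antipodal_lower binary_rank C D) = (M \notin X).
Proof.
move=> CD XD MD M_max.
have w_lt Y i : M \notin Y -> Y \subset D -> i \in Y -> w i < w M.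
  move=> MY /subsetP YD iY; rewrite ltn_neqAle M_max ?YD // andbT (inj_eq w_inj).
  by apply: contraNneq MY => <-.
have MC : M \notin C by rewrite (disjointFl CD MD).
rewrite inE powersetE XD /=; have [MX|MX] := boolP (M \in X) => /=.
  apply/negbTE; rewrite -leqNgt ltnW //; apply: (@binary_rank_lt _ _ M).
    by rewrite !inE MX (negPf MC).
  move=> i; rewrite !inE negb_or => /andP[/andP[iC iX]]; rewrite (negPf iC) iX /=.
  by move=> iD; apply: (w_lt (D :\: X)); rewrite ?subsetDl // inE ?MX ?iX.
apply: (@binary_rank_lt _ _ M); first by rewrite !inE (negPf MC) (negPf MX) MD.
by move=> i; rewrite !inE negb_or => /andP[/andP[/negPf-> _]]; apply: w_lt.
Qed.

End BinaryRank.

Section ReverseBinaryRanks.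

Variables (T : finType) (w1 w2 : T -> nat).
Hypothesis w1_inj : injective w1.
Hypothesis w_rev : forall i j, (w2 i <= w2 j) = (w1 j <= w1 i).
Implicit Types C D : {set T}.

Let w2_inj : injective w2.
Proof.
by move=> i j eq_w2; apply/w1_inj/eqP; rewrite eqn_leq -!w_rev eq_w2 leqnn.
Qed.

Lemma card_antipodal_inversions_binary_rank C D : [disjoint C & D] ->
  4 * #|antipodal_lower (binary_rank w1) C D
          :\: antipodal_lower (binary_rank w2) C D| =
  2 ^ #|D| * (1 < #|D|).
Proof.
move=> CD; case: ltnP => [/card_gt1P[i0 [j0 [i0D j0D i0j0]]]|D_small]; last first.
  by rewrite (antipodal_lowerD_small C (binary_rank_linear w1_inj)
    (binary_rank_linear w2_inj)) ?cards0 ?muln0.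
have [M /= MD M_max] := arg_maxnP w1 i0D; have [m /= mD m_max] := arg_maxnP w2 i0D.
have m_neq_M : m != M.
  apply: contraNneq i0j0 => mM; rewrite -(inj_eq w1_inj).
  have w1M i : i \in D -> w1 i = w1 M.
    by move=> iD; apply/eqP; rewrite eqn_leq M_max // -w_rev -mM m_max.
  by rewrite !w1M.
rewrite muln1 -(card_subsets_separating mD MD m_neq_M); congr (_ * _).
apply: eq_card => X; rewrite in_setD [in RHS]inE powersetE.
have [XD|XD] := boolP (X \subset D); last by rewrite !inE (negPf XD) andbF.
rewrite (mem_antipodal_lower_binary_rank w1_inj CD XD MD M_max).
rewrite (mem_antipodal_lower_binary_rank w2_inj CD XD mD m_max).
by rewrite negbK.
Qed.

Lemma card_inversions_binary_rank :
  4 * #|inversions (binary_rank w1) (binary_rank w2)| =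
  2 ^ #|T| * (2 ^ #|T| - #|T|.+1).
Proof.
rewrite card_inversions_antipodal -?sum_cubes_gt1; last exact: binary_rank_inj.
rewrite big_distrr; apply: eq_bigr => D _; rewrite big_distrr; apply: eq_bigr => C.
rewrite powersetCE => CD; exact: card_antipodal_inversions_binary_rank.
Qed.

End ReverseBinaryRanks.

Lemma led_powerset (T : finType) :
  4 * led {set T} = 2 ^ #|T| * (2 ^ #|T| - #|T|.+1).
Proof.
pose w1 (i : T) : nat := enum_rank i; pose w2 (i : T) : nat := rev_ord (enum_rank i).
have w1_inj : injective w1 by move=> i j /ord_inj/enum_rank_inj.
have w2_inj : injective w2 by move=> i j /ord_inj/rev_ord_inj/enum_rank_inj.
have w_rev i j : (w2 i <= w2 j) = (w1 j <= w1 i).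
  by rewrite leq_sub2lE.
have inversions_eq := card_inversions_binary_rank w1_inj w_rev.
have r1_lin := binary_rank_linear w1_inj; have r2_lin := binary_rank_linear w2_inj.
rewrite (led_eq_inversions r1_lin r2_lin) // => s1 s2 s1_lin s2_lin.
by rewrite -(leq_pmul2l (isT : 0 < 4)) inversions_eq card_inversions_le.
Qed.

Local Open Scope ring_scope.

Theorem theorem1 (n : nat) (hn : (1 <= n)%N) :
  (led (boolean_lattice n))%:R
    = (2%:R : rat) ^ (2 * n%:Z - 2) - (n%:R + 1) * (2%:R : rat) ^ (n%:Z - 2).
Proof.
have led_eq : (4 * led (boolean_lattice n) = 2 ^ n * (2 ^ n - n.+1))%N.
  by have := led_powerset 'I_n; rewrite card_ord.
move: (led _) led_eq => l /(congr1 (fun k => k%:R : rat)).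
rewrite !natrM natrB; last exact: ltn_expl.
rewrite natrX -(natr1 n) => led_eq.
have -> : 2 * n%:Z - 2 = n%:Z + n%:Z - 2 by ring.
rewrite !expfzDr // -!exprnP -exprnN.
by apply: (@mulfI _ 4%:R) => //; rewrite [LHS]led_eq; field.
Qed.
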